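(* Suppose a link $L=\widehat{w}$ is the braid closure of a positive $w\in\mathrm{Br}_3$ that is not of the form $\sigma_i^n$. Then $\Delta_L$ has at least $r_L:=\frac23\big(\deg(\Delta_L)-1\big)$ roots, counted with multiplicity, on the arc $\mathcal{A}_R=\{e^{i\theta}:|\theta|<2\pi/3\}$. More precisely, let $\mu_L$ be the number of components of $L$, and let $\lceil r_L\rceil_{\mathrm{odd}}$ and $\lceil r_L\rceil_{\mathrm{even}}$ denote the smallest odd and even integers, respectively, that are at least $r_L$. If $\mu_L$ is odd, then the number of roots of $\Delta_L$ in $\mathcal{A}_R$ is at least $\lceil r_L\rceil_{\mathrm{even}}$. If $\mu_L$ is even, the number of roots of $\Delta_L$ in $\mathcal{A}_R$ is at least $\lceil r_L\rceil_{\mathrm{odd}}$.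
   Context: $\mathrm{Br}_3 = \langle \sigma_1, \sigma_2 \mid \sigma_1\sigma_2\sigma_1 = \sigma_2\sigma_1\sigma_2\rangle$ is the 3-strand braid group; $w$ is positive if it is a product of positive powers of $\sigma_1,\sigma_2$; the excluded braids $\sigma_i^n$ ($i\in\{1,2\}$, $n\ge0$) include the identity. $\widehat{w}$ is the oriented link in $S^3$ that is the braid closure of $w$. The reduced Burau representation $B_t : \mathrm{Br}_3 \to \mathrm{GL}_2(\mathbb{Z}[t^{\pm1}])$ is given by $B_t(\sigma_1) = \begin{pmatrix} -t & 1\\ 0 & 1\end{pmatrix}$, $B_t(\sigma_2) = \begin{pmatrix} 1 & 0 \\ t & -t\end{pmatrix}$. The Alexander polynomial is $\Delta_{\widehat{w}}(t)=\det(B_t(w)-I)/(t^2+t+1)\in\mathbb{Z}[t^{\pm1}]$, well defined up to units $\pm t^k$; its degree is that of the representative which is a polynomial in $t$ with nonzero constant term. *)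

(* Defs.v *)
From HB Require Import structures.
From mathcomp Require Import all_boot all_order all_algebra all_fingroup.
From mathcomp Require Import complex ring.
From mathcomp Require Import boolp classical_sets reals trigo.

Set Implicit Arguments.
Unset Strict Implicit.
Unset Printing Implicit Defensive.

Import Order.TTheory GRing.Theory Num.Theory.
Local Open Scope ring_scope.

(* Br_3 is presented as words in the letters sigma_i^{+-1} modulo the congruence
   braid_eq generated by free cancellation and the braid relation; functions on
   Br_3 are functions on words that respect braid_eq. *)

Inductive gen := sigma1 | sigma2.

(* (g, false) is the letter g and (g, true) is the letter g^-1. *)
Definition braid_word := seq (gen * bool).

Definition positive_word (u : seq gen) : braid_word := [seq (g, false) | g <- u].

Inductive braid_eq : braid_word -> braid_word -> Prop :=
| braid_eq_refl u : braid_eq u u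
| braid_eq_sym u v : braid_eq u v -> braid_eq v u
| braid_eq_trans u v w : braid_eq u v -> braid_eq v w -> braid_eq u w
| braid_eq_cat u u' v v' :
    braid_eq u u' -> braid_eq v v' -> braid_eq (u ++ v) (u' ++ v')
| braid_eq_cancel g e : braid_eq [:: (g, e); (g, ~~ e)] [::]
| braid_eq_rel : braid_eq (positive_word [:: sigma1; sigma2; sigma1])
                          (positive_word [:: sigma2; sigma1; sigma2]).

Definition positive_braid (w : braid_word) : Prop :=
  exists u : seq gen, braid_eq w (positive_word u).

Definition gen_power (w : braid_word) : Prop :=
  exists (g : gen) (n : nat), braid_eq w (positive_word (nseq n g)).

Definition perm_gen (g : gen) : 'S_3 :=
  match g with
  | sigma1 => tperm (inord 0) (inord 1)
  | sigma2 => tperm (inord 1) (inord 2)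
  end.

(* Each perm_gen g is an involution, so the signs of the letters play no role. *)
Definition braid_perm (w : braid_word) : 'S_3 :=
  (\prod_(x <- w) perm_gen x.1)%g.

(* Closing the braid joins the endpoint of the strand starting at position i,
   which is at position braid_perm w i, to the strand starting there: the
   components of the closure are the cycles of braid_perm w. *)
Definition closure_components (w : braid_word) : nat := #|porbits (braid_perm w)|.

Section Burau.
Variables (F : fieldType) (t : F).

Definition mx2 (a b c d : F) : 'M[F]_2 :=
  \matrix_(i, j) if i == 0 then (if j == 0 then a else b)
                 else (if j == 0 then c else d).

Definition burau_gen (g : gen) : 'M[F]_2 :=
  match g with
  | sigma1 => mx2 (- t) 1 0 1
  | sigma2 => mx2 1 0 t (- t)
  end.

Definition burau (w : braid_word) : 'M[F]_2 :=
  \prod_(x <- w) (if x.2 then (burau_gen x.1)^-1 else burau_gen x.1).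

End Burau.

(* Z[t, t^-1] is viewed inside the field of fractions of Z[t]; tvar is the
   indeterminate t. *)
Definition Qt := {fraction {poly int}}.

Definition tvar : Qt := tofrac 'X.

Definition alexander (w : braid_word) : Qt :=
  \det (burau tvar w - 1) / (tvar ^+ 2 + tvar + 1).

Definition alexander_rep (w : braid_word) (p : {poly int}) : Prop :=
  p.[0] != 0 /\
  exists (e : bool) (k : int), tofrac p = (-1) ^+ e * tvar ^ k * alexander w.

Definition pdegree (p : {poly int}) : nat := (size p).-1.

Section Arc.
Variable R : realType.

Definition arcR : set R[i] :=
  [set z | exists2 theta : R, `|theta| < 2 * pi / 3 &
           z = (cos theta +i* sin theta)%C].

Definition complex_roots (p : {poly int}) : seq R[i] :=
  sval (closed_field_poly_normal (map_poly intr p : {poly R[i]})).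

(* Each root occurs in complex_roots p as many times as its multiplicity. *)
Definition nroots_arc (p : {poly int}) : nat :=
  count (fun z => `[< arcR z >]) (complex_roots p).

End Arc.

Definition r_of (p : {poly int}) : rat := 2 / 3 * ((pdegree p)%:R - 1).

Definition smallest_int (P : int -> Prop) (m : int) : Prop :=
  P m /\ forall k : int, P k -> m <= k.

Definition ceil_even (r : rat) (m : int) : Prop :=
  smallest_int (fun k => (2 %| k)%Z /\ r <= k%:~R) m.

Definition ceil_odd (r : rat) (m : int) : Prop :=
  smallest_int (fun k => ~~ (2 %| k)%Z /\ r <= k%:~R) m.

(* The permutation and the Burau matrix depend only on the braid. *)

Lemma braid_perm_eq u v : braid_eq u v -> braid_perm u = braid_perm v.
Proof.
rewrite /braid_perm.
elim=> {u v} [//|//|u v w _ -> _ -> //|u u' v v' _ IHu _ IHv|g e|].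
- by rewrite !big_cat IHu IHv.
- by rewrite !big_cons !big_nil mulg1 /=; case: g; rewrite tperm2.
rewrite !big_cons !big_nil !mulg1 /=; apply/permP=> i.
rewrite !permM; apply/val_inj.
by case: i => [[|[|[|//]]] hi]; rewrite !permE /= -!val_eqE /= !inordK //=;
  do ?[rewrite -!val_eqE /= !inordK //=].
Qed.

Lemma burau_gen_unit (F : fieldType) (t : F) g :
  t != 0 -> burau_gen t g \is a GRing.unit.
Proof.
move=> t0.
have -> : (burau_gen t g \is a GRing.unit) = (\det (burau_gen t g) \is a GRing.unit).
  by [].
rewrite unitfE (expand_det_row _ ord0) !big_ord_recl big_ord0 /cofactor !det_mx11.
case: g; rewrite !mxE /= -oppr_eq0; set d := (X in X != 0).
  by have -> : d = t by rewrite /d; ring.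
by have -> : d = t by rewrite /d; ring.
Qed.

Lemma burau_eq (F : fieldType) (t : F) u v :
  t != 0 -> braid_eq u v -> burau t u = burau t v.
Proof.
move=> t0; rewrite /burau.
elim=> {u v} [//|//|u v w _ -> _ -> //|u u' v v' _ IHu _ IHv|g e|].
- by rewrite !big_cat IHu IHv.
- rewrite !big_cons !big_nil mulr1 /=.
  by case: e => /=; rewrite ?mulVr ?mulrV // burau_gen_unit.
rewrite !big_cons !big_nil !mulr1 /=; apply/matrixP=> i j.
rewrite -!mulmxE; do 6?rewrite ?mxE ?big_ord_recl ?big_ord0 /=.
by case: i => [[|[|//]] hi]; case: j => [[|[|//]] hj] /=; ring.
Qed.

Lemma tvar_neq0 : tvar != 0.
Proof. by rewrite tofrac_eq0 polyX_eq0. Qed.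

(* Main.v *)
Require Import Defs.
From mathcomp Require Import all_boot all_order all_algebra all_fingroup.
From mathcomp Require Import complex polyrcf ring lra zify.
From mathcomp Require Import boolp reals trigo.

(** Let n be the length of a positive word u in which both letters occur, and
    put t = - s^2.  The Burau matrices satisfy B_i = s M_i with M_i of
    determinant 1 and trace x = s + 1/s, and the trace of M_1 M_2 is 1.  Hence
    the trace of the word in M_1, M_2 is a real polynomial T(x), and
      det (B - 1) = 1 - tr B + (- t)^n = s^n F(x),  F(x) = (s^n + s^-n) - T(x).
    On the unit circle x = 2 cos phi, and the arc |theta| < 2 pi / 3 is the part
    x^2 < 3.  There the Squier form is definite, so M_1 and M_2 are unitary and
    |T| <= 2.  At phi = k pi / n the first term of F is 2 (-1)^k, so F
    alternates weakly in sign over the k with n/6 < k < 5n/6.  Weak alternation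
    at N points forces N - 1 real roots counted with multiplicity
    ([alternation_bound]), which is at least 2n/3 - 2.

    The degree of the Alexander polynomial is at most n - 2
    ([pdegree_alexander]), so this count is at least r_L.  The refinement by
    the number of components is a parity argument: F (- x) = (-1)^n F x makes
    the number of roots of F in (- sqrt 3, sqrt 3) congruent to n
    ([root_parity]), while the sign of the permutation makes n even exactly
    when the number of components is odd ([odd_closure_components]).

    Unitarity is used through a real quadratic form: the words span a
    four-dimensional real algebra with basis 1, M_1, M_2, M_1 M_2, the
    determinant is a quadratic form N in the coordinates, and 4 N - tr^2 is
    nonnegative when x^2 <= 3 ([trace_word_bound]).

    Multiplicities are transported from F to the Alexander polynomial by
    counting the roots, in the upper half {|s| = 1, Im s > 1/2} of the preimage
    of the arc, of both sides of the polynomial form of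
    det (B - 1) (- s^2) = s^n F (s + 1/s) ([nroots_alex_num]). *)

Set Implicit Arguments.
Unset Strict Implicit.
Unset Printing Implicit Defensive.

Import Order.TTheory GRing.Theory Num.Theory.
Local Open Scope ring_scope.

(** * Traces of positive words in the algebra of two 2x2 matrices *)

Section TraceAlgebra.
Variables (A : comNzRingType) (y e : A).

(** Coordinates of a word in the basis 1, B1, B2, B1 B2 of the algebra generated
    by two matrices with tr B1 = tr B2 = y and det B1 = det B2 = tr (B1 B2) = e.
    The branches are left multiplication by B1 and by B2; the product B2 B1 is
    removed by the polarized Cayley-Hamilton identity
    B1 B2 + B2 B1 = y B1 + y B2 + (e - y^2). *)
Fixpoint coords (u : seq gen) : A * A * A * A :=
  match u with
  | [::] => (1, 0, 0, 0)
  | g :: u' =>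
    let: (a, b, c, d) := coords u' in
    match g with
    | sigma1 => (- (e * b), a + y * b, - (e * d), c + y * d)
    | sigma2 => (b * (e - y ^+ 2) - e * c - e * y * d, y * b + e * d,
                 a + y * b + y * c + e * d, - b)
    end
  end.

Definition trace_word (u : seq gen) : A :=
  let: (a, b, c, d) := coords u in 2 * a + y * (b + c) + e * d.

(** If y = 1 + e then B1 has eigenvalues 1 and e, and the first trace is
    1 + e^n: this is det (B - 1).  Writing it as a difference of traces makes it
    homogeneous in (y, e). *)
Definition char_diff (u : seq gen) : A :=
  trace_word (nseq (size u) sigma1) - trace_word u.

End TraceAlgebra.

(** Passing from (y, e) to (s y, s^2 e) multiplies both matrices by s.  The four
    coordinates have weights n, n - 1, n - 1, n - 2, so the induction carries the
    missing powers of s on the left. *)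
Lemma trace_wordZ (A : comNzRingType) (s y e : A) u :
  trace_word (s * y) (s ^+ 2 * e) u = s ^+ size u * trace_word y e u.
Proof.
have: let: (a, b, c, d) := coords y e u in
      let: (a', b', c', d') := coords (s * y) (s ^+ 2 * e) u in
      [/\ a' = s ^+ size u * a, s * b' = s ^+ size u * b,
          s * c' = s ^+ size u * c & s ^+ 2 * d' = s ^+ size u * d].
  elim: u => [|g u] /=; first by split; ring.
  move: (coords y e u) (coords (s * y) (s ^+ 2 * e) u) => [[[a b] c] d] [[[a' b'] c'] d'].
  move=> /= [Ha Hb Hc Hd]; rewrite [s ^+ (size u).+1]exprS.
  move: (s ^+ size u) Ha Hb Hc Hd => k Ha Hb Hc Hd; case: g => /=; split.
  - by transitivity (- (s * (e * (k * b)))); [rewrite -Hb | ]; ring.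
  - by transitivity (s * (k * a + y * (k * b))); [rewrite -Ha -Hb | ]; ring.
  - by transitivity (- (s * (e * (k * d)))); [rewrite -Hd | ]; ring.
  - by transitivity (s * (k * c + y * (k * d))); [rewrite -Hc -Hd | ]; ring.
  - transitivity (s * ((k * b) * (e - y ^+ 2) - e * (k * c) - e * y * (k * d))).
      by rewrite -Hb -Hc -Hd; ring.
    by ring.
  - by transitivity (s * (y * (k * b) + e * (k * d))); [rewrite -Hb -Hd | ]; ring.
  - transitivity (s * (k * a + y * (k * b) + y * (k * c) + e * (k * d))).
      by rewrite -Hb -Hd -Ha -Hc; ring.
    by ring.
  - by transitivity (- (s * (k * b))); [rewrite -Hb | ]; ring.
rewrite /trace_word; move: (coords y e u) (coords (s * y) (s ^+ 2 * e) u).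
move=> [[[a b] c] d] [[[a' b'] c'] d'] /= [Ha Hb Hc Hd].
transitivity (2 * (s ^+ size u * a) + y * (s ^+ size u * b + s ^+ size u * c)
   + e * (s ^+ size u * d)); last by ring.
by rewrite -Ha -Hb -Hc -Hd; ring.
Qed.

Lemma char_diffZ (A : comNzRingType) (s y e : A) u :
  char_diff (s * y) (s ^+ 2 * e) u = s ^+ size u * char_diff y e u.
Proof. by rewrite /char_diff !trace_wordZ size_nseq mulrBr. Qed.

Lemma rmorph_trace_word (A B : comNzRingType) (f : {rmorphism A -> B}) y e u :
  f (trace_word y e u) = trace_word (f y) (f e) u.
Proof.
rewrite /trace_word.
have <- : (let: (a, b, c, d) := coords y e u in (f a, f b, f c, f d)) =
       coords (f y) (f e) u.
  elim: u => [|g u] /=; first by rewrite rmorph1 rmorph0.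
  case: (coords y e u) => [[[a b] c] d] /= <-.
  by case: g => /=; congr (_, _, _, _); rewrite ?(rmorphB, rmorphD, rmorphN, rmorphM, rmorphXn).
case: (coords y e u) => [[[a b] c] d].
by rewrite rmorphD rmorphD !rmorphM rmorph_nat rmorphD.
Qed.

Lemma rmorph_char_diff (A B : comNzRingType) (f : {rmorphism A -> B}) y e u :
  f (char_diff y e u) = char_diff (f y) (f e) u.
Proof. by rewrite rmorphB !rmorph_trace_word. Qed.

(** The powers of B1 stay in the span of 1 and B1; evaluating a + b B1 at the
    eigenvalues 1 and e gives the two invariants of the induction. *)
Lemma trace_word_power (A : comNzRingType) (e : A) n :
  trace_word (1 + e) e (nseq n sigma1) = 1 + e ^+ n.
Proof.
rewrite /trace_word.
have: let: (a, b, c, d) := coords (1 + e) e (nseq n sigma1) in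
      [/\ a + b = 1, a + e * b = e ^+ n, c = 0 & d = 0].
  elim: n => [|n] /=; first by split; ring.
  case: (coords _ _ _) => [[[a b] c] d] /= [H1 H2 -> ->].
  by split; [rewrite -[RHS]H1 | rewrite exprS -H2 | | ]; ring.
case: (coords _ _ _) => [[[a b] c] d] /= [H1 <- -> ->].
by have -> : a = 1 - b; [rewrite -H1 addrK | ring].
Qed.

(** Modulo e^2 - e + 1 the algebra has two characters, sending both generators
    to 1 and to e respectively, and the trace is their sum.  With e = - t this
    is the divisibility by t^2 + t + 1. *)
Lemma trace_word_mod (A : comNzRingType) (e : A) u :
  exists k, trace_word (1 + e) e u = 1 + e ^+ size u + (e ^+ 2 - e + 1) * k.
Proof.
rewrite /trace_word.
have [k [l]]: exists k l, let: (a, b, c, d) := coords (1 + e) e u in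
      a + b + c + d = 1 + (e ^+ 2 - e + 1) * k /\
      a + e * b + e * c + e ^+ 2 * d = e ^+ size u + (e ^+ 2 - e + 1) * l.
  elim: u => [|g u IHu] /=; first by exists 0, 0; split; ring.
  case: IHu => k [l]; case: (coords _ _ _) => [[[a b] c] d] /= [H1 H2].
  have {}H1 : a = 1 + (e ^+ 2 - e + 1) * k - b - c - d by rewrite -H1; ring.
  have {}H2 : e ^+ size u = a + e * b + e * c + e ^+ 2 * d - (e ^+ 2 - e + 1) * l.
    by rewrite H2; ring.
  rewrite [e ^+ (size u).+1]exprS H2 {H2}; case: g => /=.
    exists k, (e * l); split; first by rewrite H1; ring.
    by ring.
  by exists (k - b - d), (e * l - b - e * d); split; rewrite H1; ring.
case: (coords _ _ _) => [[[a b] c] d] /= [H1 H2].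
exists (k + l - d).
transitivity ((1 + (e ^+ 2 - e + 1) * k) + (e ^+ size u + (e ^+ 2 - e + 1) * l)
  - (e ^+ 2 - e + 1) * d); last by ring.
by rewrite -H1 -H2; ring.
Qed.

(** The case n = 0 excludes the empty word. *)
Definition both_letters (u : seq gen) : Prop :=
  forall g n, u <> nseq n g.

(** At t = 0 both generators are idempotent, so a word depends only on the order
    in which its letters alternate; once a second letter appears only three
    coordinate vectors are ever reached, all of trace zero. *)
Lemma trace_word_mixed (A : comNzRingType) u :
  both_letters u -> trace_word (1 : A) 0 u = 0.
Proof.
have: [\/ exists g n, u = nseq n g, coords (1 : A) 0 u = (-1, 1, 1, -1),
  coords (1 : A) 0 u = (0, 0, 0, 1) | coords (1 : A) 0 u = (0, 0, 0, 0)].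
  have pow1 n : coords (1 : A) 0 (nseq n.+1 sigma1) = (0, 1, 0, 0).
    by elim: n => [|n /= ->]; rewrite /=; congr (_, _, _, _); ring.
  have pow2 n : coords (1 : A) 0 (nseq n.+1 sigma2) = (0, 0, 1, 0).
    by elim: n => [|n /= ->]; rewrite /=; congr (_, _, _, _); ring.
  elim: u => [|g u [[h [[|n] ->]]|H|H|H]].
  - by constructor 1; exists sigma1, 0%N.
  - by constructor 1; exists g, 1%N.
  - case: g h => [] [].
    + by constructor 1; exists sigma1, n.+2.
    + by constructor 3; move: (pow2 n) => /= ->; congr (_, _, _, _); ring.
    + by constructor 2; move: (pow1 n) => /= ->; congr (_, _, _, _); ring.
    + by constructor 1; exists sigma2, n.+2.
  - rewrite /= H; case: g; [constructor 4|constructor 2]; congr (_, _, _, _); ring.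
  - rewrite /= H; case: g; [constructor 3|constructor 4]; congr (_, _, _, _); ring.
  - rewrite /= H; constructor 4; case: g; congr (_, _, _, _); ring.
rewrite /trace_word; case=> [[g [n ->]] /(_ g n)//| -> | -> | -> ] _; ring.
Qed.

Lemma both_letters_size u : both_letters u -> (1 < size u)%N.
Proof.
case: u => [|g [|//]] H; first by case: (H sigma1 0%N).
by case: (H g 1%N).
Qed.

(** det (B - 1) as an element of Z[t]. *)
Definition alex_num (u : seq gen) : {poly int} := char_diff (1 - 'X) (- 'X) u.

Lemma alex_numE u : alex_num u = 1 + (- 'X) ^+ size u - trace_word (1 - 'X) (- 'X) u.
Proof. by rewrite /alex_num /char_diff trace_word_power. Qed.

Lemma alex_num_dvd u : exists h, alex_num u = ('X ^+ 2 + 'X + 1) * h.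
Proof.
have [k Hk] := trace_word_mod (- 'X : {poly int}) u.
by exists (- k); rewrite alex_numE Hk; ring.
Qed.

(** The constant term 1 shows at once that the Alexander polynomial is nonzero
    and that its normalized representative is obtained without a shift. *)
Lemma alex_num0 u : both_letters u -> (alex_num u).[0] = 1.
Proof.
move=> mu; rewrite alex_numE.
have -> : (1 + (- 'X) ^+ size u - trace_word (1 - 'X) (- 'X) u).[0] =
  1 + 0 ^+ size u - trace_word (1 : int) 0 u.
  rewrite -[LHS]/(horner_eval 0 _) rmorphB rmorph_trace_word /= /horner_eval.
  by rewrite !(hornerE, horner_exp) oppr0.
rewrite trace_word_mixed //.
by rewrite expr0n; case: (size u) (both_letters_size mu).
Qed.

Lemma size_mul_le (A : nzRingType) (p q : {poly A}) i j :
  (size p <= i.+1)%N -> (size q <= j)%N -> (size (p * q)%R <= i + j)%N.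
Proof. by move=> hp hq; have := size_polyMleq p q; lia. Qed.

Lemma size_add_le (A : nzRingType) (p q : {poly A}) i :
  (size p <= i)%N -> (size q <= i)%N -> (size (p + q)%R <= i)%N.
Proof. by move=> hp hq; rewrite (leq_trans (size_polyD _ _)) // geq_max hp. Qed.

Lemma size_sub_le (A : nzRingType) (p q : {poly A}) i :
  (size p <= i)%N -> (size q <= i)%N -> (size (p - q)%R <= i)%N.
Proof. by move=> hp hq; rewrite size_add_le ?size_polyN. Qed.

(** The coordinates have degrees at most n, n - 1, n - 1 and n - 2.  The
    truncated bound n.-1 on the size of d is not inductive at n = 0, so the
    induction on words starts at length one. *)
Lemma size_trace_word (A : comNzRingType) (y e : {poly A}) u :
  (size y <= 2)%N -> (size e <= 2)%N ->
  (size (trace_word y e u) <= (size u).+1)%N.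
Proof.
move=> hy he; rewrite /trace_word.
have: let: (a, b, c, d) := coords y e u in
    [/\ (size a <= (size u).+1)%N, (size b <= size u)%N, (size c <= size u)%N
      & (size d <= (size u).-1)%N].
  elim: u => [|g [|h u] IHu].
  - by rewrite /= size_poly0 size_poly1.
  - by case: g {IHu}; rewrite /= !(mulr0, oppr0, add0r, addr0, subr0, mul0r);
      rewrite size_poly0 size_poly1.
  - have: size (h :: u) = (size u).+1 by [].
    move: (h :: u) (size u) IHu => v m + /= sv; rewrite sv /=.
    case: (coords y e v) => [[[a b] c] d] /= [ha hb hc hd].
    have W i j (p : {poly A}) : (size p <= i)%N -> (i <= j)%N -> (size p <= j)%N.
      exact: leq_trans.
    have hyy : (size (e - y ^+ 2)%R <= 3)%N.
      by rewrite size_sub_le ?(W _ _ _ he) // expr2 (@size_mul_le _ _ _ 1 2).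
    case: g; split; rewrite ?size_polyN ?(W _ _ _ hb) //.
    + rewrite (@W m.+2) //; exact: (@size_mul_le _ _ _ 1 m.+1).
    + rewrite size_add_le //; exact: (@size_mul_le _ _ _ 1 m.+1).
    + rewrite (@W m.+1) //; exact: (@size_mul_le _ _ _ 1 m).
    + rewrite size_add_le //; exact: (@size_mul_le _ _ _ 1 m).
    + rewrite !size_sub_le //.
      * by rewrite mulrC; exact: (@size_mul_le _ _ _ 2 m.+1).
      * by rewrite (@W m.+2) //; exact: (@size_mul_le _ _ _ 1 m.+1).
      * rewrite (@W m.+2) // -mulrA.
        by rewrite (@size_mul_le _ _ _ 1 m.+1) // (@size_mul_le _ _ _ 1 m).
    + rewrite size_add_le //; first exact: (@size_mul_le _ _ _ 1 m.+1).
      by rewrite (@W m.+1) //; exact: (@size_mul_le _ _ _ 1 m).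
    + rewrite !size_add_le //; try exact: (@size_mul_le _ _ _ 1 m.+1).
      by rewrite (@W m.+1) //; exact: (@size_mul_le _ _ _ 1 m).
case: (coords y e u) => [[[a b] c] d] /= [ha hb hc hd].
rewrite !size_add_le //.
- by rewrite mulr_natl mulr2n size_add_le.
- by rewrite (@size_mul_le _ _ _ 1 (size u)) // size_add_le.
- by apply: (@leq_trans (1 + (size u).-1)%N); [exact: size_mul_le | lia].
Qed.

Lemma size_char_diff (A : comNzRingType) (y e : {poly A}) u :
  (size y <= 2)%N -> (size e <= 2)%N ->
  (size (char_diff y e u) <= (size u).+1)%N.
Proof.
move=> hy he; rewrite size_sub_le ?size_trace_word //.
by rewrite -{2}(size_nseq (size u) sigma1) size_trace_word.
Qed.

Lemma size_alex_num u : (size (alex_num u) <= (size u).+1)%N.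
Proof.
by rewrite size_char_diff ?size_polyN ?size_polyX // size_sub_le ?size_polyX ?size_poly1.
Qed.

(** * The Alexander polynomial as a difference of traces *)

Lemma det2 (F : comNzRingType) (M : 'M[F]_2) :
  \det M = M 0 0 * M 1 1 - M 0 1 * M 1 0.
Proof.
rewrite (expand_det_row _ ord0) !big_ord_recl big_ord0 /cofactor !det_mx11 !mxE /=.
rewrite addr0 !expr0 !expr1 mul1r mulN1r mulrN /=.
by congr (M _ _ * M _ _ - M _ _ * M _ _); apply/val_inj.
Qed.

Section BurauTrace.
Variables (F : fieldType) (t : F).

Lemma burau_positive u :
  burau t (positive_word u) = \prod_(g <- u) burau_gen t g.
Proof. by rewrite /burau big_map. Qed.

(** Matrix form of a + b B1 + c B2 + d B1 B2 for the Burau matrices, where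
    y = 1 - t and e = - t. *)
Lemma burau_coords u :
  let: (a, b, c, d) := coords (1 - t) (- t) u in
  \prod_(g <- u) burau_gen t g =
  mx2 (a - t * b + c) (b - t * d) (t * c + t * d) (a + b - t * c - t * d).
Proof.
elim: u => [|g u] /=.
  rewrite big_nil; apply/matrixP => i j; rewrite !mxE.
  by case: i => [[|[|//]] hi]; case: j => [[|[|//]] hj] /=; ring.
rewrite big_cons; case: (coords _ _ u) => [[[a b] c] d] /= ->.
case: g => /=; apply/matrixP => i j;
rewrite -mulmxE !mxE !big_ord_recl big_ord0 !mxE /=;
by case: i => [[|[|//]] hi]; case: j => [[|[|//]] hj] /=; ring.
Qed.

Lemma det_burau_sub1 u :
  \det (burau t (positive_word u) - 1) = char_diff (1 - t) (- t) u.
Proof.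
rewrite burau_positive /char_diff trace_word_power.
have dB : \det (\prod_(g <- u) burau_gen t g) = (- t) ^+ size u.
  elim: u => [|g u IHu]; first by rewrite big_nil det1.
  rewrite big_cons -mulmxE det_mulmx IHu exprS; congr (_ * _).
  by case: g; rewrite det2 !mxE /=; ring.
rewrite /trace_word -dB; have := burau_coords u.
by case: (coords _ _ _) => [[[a b] c] d] ->; rewrite !det2 !mxE /=; ring.
Qed.
End BurauTrace.

Lemma alexander_positive u :
  alexander (positive_word u) = tofrac (alex_num u) / tofrac ('X ^+ 2 + 'X + 1).
Proof.
rewrite /alexander det_burau_sub1 rmorph_char_diff /= /tvar; congr (_ / _).
  by rewrite rmorphB rmorph1 rmorphN.
by rewrite !rmorphD rmorphXn rmorph1.
Qed.

Lemma alexander_eq w u : braid_eq w u -> alexander w = alexander u.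
Proof. by move=> wu; rewrite /alexander (burau_eq tvar_neq0 wu). Qed.

(** Every letter is a transposition, so the sign of the permutation is the
    parity of the length; it is also the parity of 3 minus the number of
    cycles. *)
Lemma odd_closure_components u :
  odd (closure_components (positive_word u)) = ~~ odd (size u).
Proof.
have: odd_perm (braid_perm (positive_word u)) = odd (size u).
  rewrite /braid_perm big_map; elim: u => [|g u IHu]; first by rewrite big_nil odd_perm1.
  rewrite big_cons odd_permM IHu /=; case: g => /=; rewrite odd_tperm -val_eqE /= !inordK //.
by rewrite /odd_perm card_ord /= /closure_components; do 2!case: (odd _).
Qed.

Lemma closure_components_eq w u :
  braid_eq w u -> closure_components w = closure_components u.
Proof. by move=> wu; rewrite /closure_components (braid_perm_eq wu). Qed.

(** Both h and a normalized representative p have nonzero constant term, so the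
    power of t relating them is trivial. *)
Lemma alexander_rep_quotient u h :
  both_letters u -> alex_num u = ('X ^+ 2 + 'X + 1) * h ->
  alexander_rep (positive_word u) h /\
  forall p, alexander_rep (positive_word u) p -> p = h \/ p = - h.
Proof.
move=> mu uh.
have h0 : h.[0] = 1 by rewrite -(alex_num0 mu) uh !(hornerE, horner_exp).
have q0 : ('X ^+ 2 + 'X + 1 : {poly int}) != 0.
  by apply/eqP => /(congr1 (horner^~ 0)); rewrite !(hornerE, horner_exp).
have alE : alexander (positive_word u) = tofrac h.
  by rewrite alexander_positive uh rmorphM mulrC mulKf // tofrac_eq0.
split; first by split; [rewrite h0 | exists false, 0; rewrite alE expr0 expr0z !mul1r].
rewrite /alexander_rep alE => p [p0 [e [k]]].
have sgn (p' : {poly int}) : p' = (-1) ^+ e * h -> p' = h \/ p' = - h.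
  by move=> ->; case: e; [right; rewrite expr1 mulN1r | left; rewrite mul1r].
have tosgn : tofrac ((-1) ^+ e * h) = (-1) ^+ e * tofrac h.
  by rewrite rmorphM rmorphXn rmorphN rmorph1.
rewrite mulrAC -tosgn; case: k => k pk; apply: sgn.
  have {}pk : p = (-1) ^+ e * h * 'X ^+ k.
    apply/eqP; rewrite -tofrac_eq pk -exprnP; apply/eqP.
    by rewrite [in RHS]rmorphM rmorphXn.
  case: k pk => [|k] pk; first by rewrite pk mulr1.
  by move: p0; rewrite pk hornerM horner_exp hornerX expr0n mulr0 eqxx.
have {}pk : p * 'X ^+ k.+1 = (-1) ^+ e * h.
  apply/eqP; rewrite -tofrac_eq tofracM pk tofracXn NegzE -exprnN mulfVK //.
  by rewrite expf_neq0 // tvar_neq0.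
have: (p * 'X ^+ k.+1).[0] != 0.
  by rewrite pk hornerM h0 mulr1 horner_exp hornerN hornerC signr_eq0.
by rewrite hornerM horner_exp hornerX expr0n mulr0 eqxx.
Qed.

(** * Roots forced by weak sign alternation *)

(** N is the determinant of a + b M1 + c M2 + d M1 M2, hence 1 on words, and
    4 N - tr^2 is minus the discriminant of the characteristic polynomial.  It
    is a positive semidefinite form in (b, c, d) as soon as x^2 <= 3; this plays
    the part of definiteness of the Squier form. *)
Lemma trace_word_bound (R : realFieldType) (x : R) u :
  x ^+ 2 <= 3 -> -2 <= trace_word x 1 u <= 2.
Proof.
move=> hx; rewrite /trace_word.
pose N a b c d := a ^+ 2 + b ^+ 2 + c ^+ 2 + d ^+ 2 + x * (a + d) * (b + c)
  + a * d + (x ^+ 2 - 1) * (b * c).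
have: let: (a, b, c, d) := coords x 1 u in N a b c d = 1.
  elim: u => [|g u] /=; first by rewrite /N; ring.
  case: (coords x 1 u) => [[[a b] c] d] /= Hu.
  by case: g => /=; rewrite -[RHS]Hu /N; ring.
case: (coords x 1 u) => [[[a b] c] d] /= HN.
rewrite mul1r; set T := (X in -2 <= X <= 2).
have id : 4 * N a b c d - T ^+ 2 =
   3 * (d + x * (b + c) / 3) ^+ 2
   + (4 / 3) * ((3 - x ^+ 2) * (b ^+ 2 + c ^+ 2 - b * c)).
  by rewrite /N /T; field.
have nn : 0 <= (3 - x ^+ 2) * (b ^+ 2 + c ^+ 2 - b * c).
  by apply: mulr_ge0; nra.
have sq : 0 <= (d + x * (b + c) / 3) ^+ 2 by exact: sqr_ge0.
have T4 : T ^+ 2 <= 4 by rewrite HN in id; lra.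
by apply/andP; split; nra.
Qed.

Section Alternation.
Variable R : rcfType.
Implicit Types (P Q G : {poly R}) (xs rs : seq R).

(** Weak inequalities: |T| may reach 2, so F may vanish at a sample point. *)
Fixpoint alternates (e : bool) P xs : Prop :=
  if xs is x :: xs' then 0 <= (-1) ^+ e * P.[x] /\ alternates (~~ e) P xs'
  else True.

(** Division by X - r reverses the sign at every point below r. *)
Lemma alternates_divr (e : bool) Q (r : R) xs :
  all (< r) xs -> alternates e (Q * ('X - r%:P)) xs -> alternates (~~ e) Q xs.
Proof.
elim: xs e => //= x xs IHxs e /andP[xr xsr] [h /(IHxs _ xsr)]; split=> //.
move: h; rewrite hornerM hornerXsubC.
by case: (e); rewrite /= ?expr0 ?expr1 ?mul1r ?mulN1r; nra.
Qed.

(** A root at a sample point may serve the gaps on both of its sides, so the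
    count must be made with multiplicity.  Take a root r between the two
    largest points and divide by X - r: discarding x0, or x1 when r = x1, leaves
    a list that alternates for the quotient. *)
Lemma alternation_bound (a b : R) e P rs G xs :
  P = \prod_(r <- rs) ('X - r%:P) * G ->
  (forall x, a < x < b -> G.[x] != 0) ->
  sorted >%R xs -> all (fun x => a < x < b) xs -> alternates e P xs ->
  (size xs <= (size rs).+1)%N.
Proof.
move=> PE G0; elim: {xs}(size xs) {-2}xs (leqnn (size xs)) rs e P PE => [|n IHn] xs.
  by rewrite leqn0 => /nilP ->.
case: xs => [|x0 [|x1 xs]] //= hn rs e P PE /andP[x10 sxs].
case/and3P=> Ix0 Ix1 Ixs [h0 [h1 alt]].
have [r /andP[r1 r0] Pr] : exists2 r, x1 <= r <= x0 & root P r.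
  have h : P.[x1] * P.[x0] <= 0.
    by move: h0 h1; case: (e); rewrite /= ?expr0 ?expr1 ?mul1r ?mulN1r; nra.
  by have [r] := polyrcf.poly_ivt (ltW x10) h; rewrite in_itv /=; exists r.
have rrs : r \in rs.
  move: Pr; rewrite PE rootM root_prod_XsubC => /orP[//|].
  by rewrite rootE (negbTE (G0 r _)) //; apply/andP; split; lra.
pose Q := \prod_(s <- rem r rs) ('X - s%:P) * G.
have PQ : P = Q * ('X - r%:P).
  by rewrite PE (perm_big _ (perm_to_rem rrs)) big_cons -mulrA mulrC.
have srs : size rs = (size (rem r rs)).+1.
  by rewrite size_rem //; case: (rs) rrs.
have x1xs : all (< x1) xs.
  by apply: order_path_min sxs; exact: rev_trans lt_trans.
rewrite srs ltnS; have [rx1|rx1] := eqVneq r x1.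
  apply: (IHn (x0 :: xs) _ _ e Q erefl) => /=; first by lia.
  - case: (xs) sxs x1xs => //= x2 xs' /andP[x21 ->] _; rewrite andbT.
    exact: lt_trans x10.
  - by rewrite Ix0.
  split.
    move: h0; rewrite PQ hornerM hornerXsubC mulrA pmulr_lge0 // subr_gt0 rx1 //.
  move: alt; rewrite negbK PQ rx1 => alt.
  exact: alternates_divr alt.
have {}r1 : x1 < r by rewrite lt_neqAle eq_sym rx1.
apply: (IHn (x1 :: xs) _ _ e Q erefl) => //=; first by rewrite Ix1.
have := @alternates_divr (~~ e) Q r (x1 :: xs); rewrite -PQ negbK; apply=> //=.
by rewrite r1; apply: sub_all x1xs => x /= xx1; exact: lt_trans xx1 r1.
Qed.

Lemma root_free_factor (a b : R) P :
  P != 0 -> exists rs G, [/\ P = \prod_(r <- rs) ('X - r%:P) * G,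
    all (fun x => a < x < b) rs & forall x, a < x < b -> G.[x] != 0].
Proof.
elim: {P}(size P) {-2}P (leqnn (size P)) => [|n IHn] P hn P0.
  by move: hn P0; rewrite leqn0 size_poly_eq0 => ->.
have [[x Ix Px]|no] := pselect (exists2 x, a < x < b & root P x).
  have [Q PQ] := factor_theorem _ _ Px.
  have Q0 : Q != 0 by apply: contraNneq P0 => Q0; rewrite PQ Q0 mul0r.
  have [|rs [G [QE Irs G0]]] := IHn Q _ Q0.
    by move: hn; rewrite PQ size_Mmonic ?monicXsubC // size_XsubC addn2.
  exists (x :: rs), G; split=> //=; last by rewrite Ix.
  by rewrite PQ QE big_cons mulrC mulrA.
exists [::], P; split=> //; first by rewrite big_nil mul1r.
by move=> x Ix; apply/negP => Px; apply: no; exists x.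
Qed.

(** Take x in the interval above all |r|.  Then G has the same sign at x and
    - x, and the product of the X - r changes by (-1)^(size rs); compare with the
    symmetry of P. *)
Lemma root_parity (b : R) P rs G n :
  0 < b -> P = \prod_(r <- rs) ('X - r%:P) * G -> all (fun x => - b < x < b) rs ->
  (forall x, - b < x < b -> G.[x] != 0) ->
  (forall x, P.[- x] = (-1) ^+ n * P.[x]) -> odd (size rs) = odd n.
Proof.
move=> b0 PE Irs G0 Psym.
have [x [/andP[x0 xb] xrs]] : exists x, 0 < x < b /\ all (fun r => - x < r < x) rs.
  elim: rs Irs {PE} => [_|r rs IHrs] /=; first by exists (b / 2); split=> //; lra.
  case/andP=> /andP[r1 r2] /IHrs[x [/andP[x0 xb] xrs]].
  (* The midpoint of |r| and b lies above |r| and below b. *)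
  pose m := Num.max x (Num.max ((r + b) / 2) ((b - r) / 2)).
  have [xm rm rm'] : [/\ x <= m, (r + b) / 2 <= m & (b - r) / 2 <= m].
    by rewrite /m !le_max !lexx !orbT.
  exists m; split; first by rewrite (lt_le_trans x0) // /m !gt_max xb /=; lra.
  apply/andP; split; first by apply/andP; split; lra.
  by apply: sub_all xrs => s /andP[s1 s2]; apply/andP; split; lra.
have pos : 0 < \prod_(r <- rs) (x - r).
  by rewrite big_seq prodr_gt0 // => r /(allP xrs)/andP[_ rx]; rewrite subr_gt0.
have neg : 0 < \prod_(r <- rs) (x + r).
  by rewrite big_seq prodr_gt0 // => r /(allP xrs)/andP[rx _]; lra.
have negE : \prod_(r <- rs) (- x - r) = (-1) ^+ size rs * \prod_(r <- rs) (x + r).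
  elim: (rs) => [|r s IHs]; first by rewrite !big_nil mulr1.
  by rewrite !big_cons IHs /= exprS; ring.
have GG : 0 < G.[- x] * G.[x].
  rewrite ltNge; apply/negP => h.
  have [|y] := polyrcf.poly_ivt _ h; first by lra.
  by rewrite in_itv /= => /andP[y1 y2]; rewrite rootE (negbTE (G0 y _)) //; lra.
have := Psym x; rewrite PE !hornerM !horner_prod.
under eq_bigr do rewrite hornerXsubC.
under [in RHS]eq_bigr do rewrite hornerXsubC.
rewrite negE -signr_odd -(signr_odd _ n).
have := mulr_gt0 neg GG; have := mulr_ge0 (ltW pos) (sqr_ge0 G.[x]).
move: (\prod_(r <- rs) (x + r)) (\prod_(r <- rs) (x - r)) => B A h1 h2.
move=> /(congr1 (fun z => z * G.[x])).
by case: (odd _); case: (odd n) => //=;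
  rewrite ?expr0 ?expr1 ?mul1r ?mulN1r => H; exfalso; nra.
Qed.
End Alternation.

(** * The arc and the sample points *)

Section Trig.
Variable R : realType.

(** The triple angle formula at pi gives (c + 1) (2 c - 1)^2 = 0. *)
Lemma cos_pi3 : cos (pi / 3) = 1 / 2 :> R.
Proof.
have p0 := pi_gt0 R.
have c0 : 0 < cos (pi / 3 : R) by apply: cos_gt0_pihalf; lra.
have s2 := cos2Dsin2 (pi / 3 : R).
have : cos (pi / 3 + pi / 3 + pi / 3 : R) = -1.
  by rewrite -cospi; congr cos; field.
rewrite !cosD sinD; move: (cos _) (sin _) c0 s2 => c s c0 s2 h.
have {}h : (c + 1) * (2 * c - 1) ^+ 2 = 0.
  transitivity ((c * c - s * s) * c - (s * c + c * s) * s + 1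
     + 3 * c * (c ^+ 2 + s ^+ 2 - 1)); first by ring.
  by rewrite h s2; ring.
move/eqP: h; rewrite mulf_eq0 expf_eq0 /= => /orP[]/eqP h; lra.
Qed.

Lemma cos_2pi3 : cos (2 * pi / 3) = - (1 / 2) :> R.
Proof.
have -> : 2 * pi / 3 = pi / 3 + pi / 3 :> R by field.
have := cos2Dsin2 (pi / 3 : R); rewrite cosD cos_pi3; nra.
Qed.

(** The square root of 3, in the form in which it is compared with 2 cos phi. *)
Definition arc_bound : R := 2 * cos (pi / 6).

Lemma arc_bound_gt0 : 0 < arc_bound.
Proof.
have p0 := pi_gt0 R.
by rewrite mulr_gt0 // cos_gt0_pihalf //; lra.
Qed.

Lemma arc_bound_sqr : arc_bound ^+ 2 = 3.
Proof.
have := cos_pi3; have -> : pi / 3 = pi / 6 + pi / 6 :> R by field.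
rewrite cosD /arc_bound; have := cos2Dsin2 (pi / 6 : R); nra.
Qed.

Lemma arc_boundP (x : R) : (- arc_bound < x < arc_bound) = (x ^+ 2 < 3).
Proof.
have b0 := arc_bound_gt0; have b2 := arc_bound_sqr.
apply/andP/idP => [[h1 h2]|h]; first by nra.
by split; rewrite ltNge; apply/negP => h'; nra.
Qed.

Lemma arcRP (z : R[i]) :
  `[< arcR z >] = (complex.Re z ^+ 2 + complex.Im z ^+ 2 == 1) && (- (1 / 2) < complex.Re z).
Proof.
have p0 := pi_gt0 R.
apply/asboolP/andP => [[th hth ->]|[]] /=.
  rewrite cos2Dsin2; split=> //; rewrite -cos_2pi3 -(cos_norm th).
  by rewrite ltr_cos // in_itv /=; apply/andP; split=> //; try lra; exact: normr_ge0.
case: z => x y /= /eqP h hx.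
have x1 : -1 <= x <= 1 by apply/andP; split; nra.
have th : acos x < 2 * pi / 3.
  rewrite -ltr_cos ?cos_2pi3 ?acosK ?in_itv //=; last by lra.
  by rewrite acos_ge0 ?acos_lepi.
have sE : sin (acos x) = `|y|.
  by rewrite sin_acos // -sqrtr_sqr; congr Num.sqrt; lra.
have [y0|y0] := leP 0 y.
  exists (acos x); first by rewrite ger0_norm ?acos_ge0.
  by rewrite acosK ?in_itv // sE ger0_norm.
exists (- acos x); first by rewrite normrN ger0_norm ?acos_ge0.
by rewrite cosN sinN acosK ?in_itv // sE ltr0_norm // opprK.
Qed.

Definition cis (x : R) : R[i] := (cos x +i* sin x)%C.

Lemma cisX x n : cis x ^+ n = cis (n%:R * x).
Proof.
elim: n => [|n IHn]; first by rewrite /cis mul0r cos0 sin0.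
rewrite exprS IHn -natr1 mulrDl mul1r addrC /cis cosD sinD.
by rewrite [LHS]/(GRing.mul _ _) /=; congr (_ +i* _)%C; ring.
Qed.

Lemma cis_nat_pi k : cis (k%:R * pi) = (-1) ^+ k.
Proof.
by rewrite -cisX /cis cospi sinpi; congr (_ ^+ k); apply/eqP; rewrite eq_complex /= oppr0 !eqxx.
Qed.

(** The values of s + 1/s at the points of the upper half circle with
    s^n = (-1)^k. *)
Definition sample (n k : nat) : R := 2 * cos (k%:R * pi / n%:R).

(** For s = exp (i k pi / n) homogeneity and the eigenvalue formula give
    s^n tr (M1^n) = 1 + s^2n, that is (-1)^k tr (M1^n) = 2. *)
Lemma trace_power_sample n k :
  (0 < n)%N -> trace_word (sample n k) 1 (nseq n sigma1) = 2 * (-1) ^+ k.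
Proof.
move=> n0; pose s := cis (k%:R * pi / n%:R).
have sn : s ^+ n = (-1) ^+ k.
  rewrite cisX -cis_nat_pi; congr cis; field.
  by rewrite pnatr_eq0 -lt0n.
have sx : s * (sample n k)%:C%C = 1 + s ^+ 2.
  rewrite /s /sample /cis; have := cos2Dsin2 (k%:R * pi / n%:R : R).
  move: (cos _) (sin _) => c t h.
  apply/eqP; rewrite eq_complex /=; apply/andP; split; apply/eqP; last by ring.
  by nra.
have := trace_wordZ s ((sample n k)%:C)%C 1 (nseq n sigma1).
rewrite sx mulr1 trace_word_power size_nseq exprAC sn sqrr_sign => h.
apply: (@complexI R); rewrite rmorph_trace_word rmorph1.
apply: (@mulfI _ ((-1) ^+ k)); first by rewrite signr_eq0.
by rewrite -h rmorphM rmorphXn rmorphN rmorph1 /= rmorph_nat mulrCA -expr2 sqrr_sign; ring.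
Qed.

(** The polynomial F with det (B - 1) = s^n F (s + 1/s). *)
Definition real_num (u : seq gen) : {poly R} := char_diff 'X 1 u.

Lemma horner_real_num u x : (real_num u).[x] = char_diff x 1 u.
Proof.
by rewrite -[LHS]/(horner_eval x _) rmorph_char_diff /= /horner_eval hornerX hornerC.
Qed.

Lemma real_num_sign u k : (0 < size u)%N -> sample (size u) k ^+ 2 <= 3 ->
  0 <= (-1) ^+ k * (real_num u).[sample (size u) k].
Proof.
move=> n0 hs; rewrite horner_real_num /char_diff trace_power_sample //.
have := trace_word_bound u hs.
by rewrite -signr_odd; case: (odd k); rewrite ?expr0 ?expr1; lra.
Qed.

Lemma sample_bound n k : (n < 6 * k)%N -> (6 * k < 5 * n)%N ->
  - arc_bound < sample n k < arc_bound.
Proof.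
move=> h1 h2; have p0 := pi_gt0 R.
have n0 : 0 < n%:R :> R by rewrite ltr0n; lia.
have {}h1 : n%:R < 6 * k%:R :> R by rewrite -natrM ltr_nat.
have {}h2 : 6 * k%:R < 5 * n%:R :> R by rewrite -!natrM ltr_nat.
have h3 : pi / 6 < k%:R * pi / n%:R :> R by rewrite ltr_pdivlMr //; nra.
have h4 : k%:R * pi / n%:R < 5 * pi / 6 :> R by rewrite ltr_pdivrMr //; nra.
have c5 : cos (5 * pi / 6) = - cos (pi / 6) :> R.
  have -> : 5 * pi / 6 = - (pi / 6) + pi :> R by field.
  by rewrite cosDpi cosN.
have l1 : cos (k%:R * pi / n%:R) < cos (pi / 6) :> R.
  by rewrite ltr_cos // in_itv /=; lra.
have l2 : cos (5 * pi / 6) < cos (k%:R * pi / n%:R) :> R.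
  by rewrite ltr_cos // in_itv /=; lra.
by rewrite c5 in l2; rewrite /arc_bound /sample; lra.
Qed.

Lemma sample_decr n j k : (j < k)%N -> (k <= n)%N -> sample n k < sample n j.
Proof.
move=> jk kn; have p0 := pi_gt0 R.
have n0 : 0 < n%:R :> R by rewrite ltr0n; lia.
have I i : (i <= n)%N -> 0 <= (i%:R : R) * pi / n%:R <= pi.
  move=> i_n; apply/andP; split; first by rewrite !mulr_ge0 ?invr_ge0 ?ler0n // ltW.
  by rewrite ler_pdivrMr // mulrC ler_pM2l // ler_nat.
rewrite ltr_pM2l // ltr_cos ?in_itv ?I //=; last by lia.
by rewrite ltr_pM2r ?invr_gt0 // ltr_pM2r // ltr_nat.
Qed.

(** The indices k are those with n < 6 k < 5 n, i.e. the sample points strictly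
    inside the interval; they are listed by increasing k and hence decreasing
    value. *)
Definition samples n := [seq sample n k | k <- iota (n %/ 6).+1 ((5 * n).-1 %/ 6 - n %/ 6)].

Lemma real_num_alternates u : (0 < size u)%N ->
  let xs := samples (size u) in
  [/\ sorted >%R xs, all (fun x => - arc_bound < x < arc_bound) xs
    & alternates (odd (size u %/ 6).+1) (real_num u) xs].
Proof.
move=> n0 xs; rewrite {}/xs /samples; set n := size u in n0 *.
set a := (n %/ 6).+1; set N := (_ - _)%N.
have rng k : k \in iota a N -> (n < 6 * k)%N /\ (6 * k < 5 * n)%N.
  by rewrite mem_iota /a /N => h; lia.
split.
- apply: (homo_sorted_in (P := fun k => k <= n)%N) (iota_ltn_sorted _ _).
    by move=> i j _ /= jn ij; apply: sample_decr.
  by apply/allP => k /rng []; rewrite /in_mem /=; lia.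
- by apply/allP => _ /mapP[k /rng[h1 h2] ->]; exact: sample_bound.
move: rng; elim: N a => //= N IHN a rng; split.
  rewrite signr_odd; apply: real_num_sign => //.
  by rewrite ltW // -arc_boundP sample_bound //; have [] := rng a (mem_head _ _).
by apply: (IHN a.+1) => k kN; apply: rng; rewrite inE kN orbT.
Qed.

End Trig.

(** * From real roots to roots on the arc *)

Section RootCount.
Variable C : closedFieldType.
Implicit Types (A : pred C) (P Q : {poly C}).

Definition nroots A P : nat := count A (sval (closed_field_poly_normal P)).

(** The count does not depend on the chosen splitting, by unique
    factorization. *)
Lemma nroots_prod A c (s : seq C) :
  c != 0 -> nroots A (c *: \prod_(z <- s) ('X - z%:P)) = count A s.
Proof.
move=> c0; rewrite /nroots; case: closed_field_poly_normal => r /= rE.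
apply/seq.permP; rewrite perm_sym; apply: prod_XsubC_eq.
have lc : lead_coef (c *: \prod_(z <- s) ('X - z%:P)) = c.
  by rewrite lead_coefZ (monicP (monic_prod_XsubC _ _ _)) mulr1.
by move: rE; rewrite lc; apply: scalerI.
Qed.

Lemma poly_split P : P != 0 ->
  exists c s, c != 0 /\ P = c *: \prod_(z <- s) ('X - z%:P).
Proof.
move=> P0; case: (closed_field_poly_normal P) => s PE.
by exists (lead_coef P), s; rewrite lead_coef_eq0.
Qed.

Lemma nrootsM A P Q : P != 0 -> Q != 0 ->
  nroots A (P * Q) = (nroots A P + nroots A Q)%N.
Proof.
move=> /poly_split[c [s [c0 ->]]] /poly_split[d [r [d0 ->]]].
rewrite -scalerAl -scalerAr scalerA -big_cat !nroots_prod ?mulf_neq0 //.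
exact: count_cat.
Qed.

Lemma nrootsZ A c P : c != 0 -> P != 0 -> nroots A (c *: P) = nroots A P.
Proof.
move=> c0 /poly_split[d [s [d0 ->]]].
by rewrite scalerA !nroots_prod ?mulf_neq0.
Qed.

Lemma nroots_XsubC A z : nroots A ('X - z%:P) = A z.
Proof.
by have := nroots_prod A [:: z] (oner_neq0 _); rewrite big_seq1 scale1r => ->; exact: addn0.
Qed.

Lemma nroots_eq0 A P : P != 0 -> (forall z, A z -> ~~ root P z) -> nroots A P = 0%N.
Proof.
move=> /poly_split[c [s [c0 ->]]] noroot; rewrite nroots_prod //.
apply/eqP; rewrite -leqn0 leqNgt -has_count; apply/hasP => -[z zs /noroot].
by rewrite rootZ // root_prod_XsubC zs.
Qed.

Lemma nroots_prodr A (I : eqType) (r : seq I) (F : I -> {poly C}) :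
  (forall i, F i != 0) -> nroots A (\prod_(i <- r) F i) = (\sum_(i <- r) nroots A (F i))%N.
Proof.
move=> F0; elim: r => [|i r IHr].
  rewrite !big_nil nroots_eq0 ?oner_neq0 // => z _; by rewrite root1.
by rewrite !big_cons nrootsM // ?IHr // prodf_seq_neq0; apply/allP => j _; exact: F0.
Qed.

(** The difference plus 1 takes only the value 1, so it has no root and must be
    constant. *)
Lemma poly_fun_inj P Q : (forall z, P.[z] = Q.[z]) -> P = Q.
Proof.
move=> PQ; apply/eqP; rewrite -subr_eq0; set D := P - Q.
have D0 z : D.[z] = 0 by rewrite hornerD hornerN PQ subrr.
have [s1|/closed_rootP[z]] := boolP (size (D + 1) == 1%N); last first.
  by rewrite rootE hornerD D0 add0r hornerC oner_eq0.
have /size_poly1P[c _ Dc] := s1.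
have {}Dc : D = (c - 1)%:P by rewrite polyCB -Dc addrK.
by have := D0 0; rewrite Dc hornerC => ->.
Qed.

End RootCount.

Section ArcCount.
Variable R : realType.
Local Notation C := (R[i]).
Local Notation toC := (real_complex R).

Definition in_arc (z : C) : bool :=
  (complex.Re z ^+ 2 + complex.Im z ^+ 2 == 1) && (- (1 / 2) < complex.Re z).

(** The upper one of the two arcs of square roots of - t for t in the arc. *)
Definition in_cap (z : C) : bool :=
  (complex.Re z ^+ 2 + complex.Im z ^+ 2 == 1) && (1 / 2 < complex.Im z).

Lemma nroots_arcE (p : {poly int}) : nroots_arc R p = nroots in_arc (map_poly intr p).
Proof.
by rewrite /nroots_arc /complex_roots /nroots; apply: eq_count => z; rewrite arcRP.
Qed.

(** Over a point of the arc lie two opposite square roots, of which exactly one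
    is in the cap; over other points there is none. *)
Lemma in_arc_sqr (s : C) : in_arc (- s ^+ 2) = (in_cap s + in_cap (- s))%N :> nat.
Proof.
case: s => a b; rewrite /in_arc /in_cap /=.
have -> : (- a) ^+ 2 + (- b) ^+ 2 = a ^+ 2 + b ^+ 2 by ring.
have -> : (- (a * a - b * b)) ^+ 2 + (- (a * b + b * a)) ^+ 2 = (a ^+ 2 + b ^+ 2) ^+ 2 by ring.
rewrite sqrp_eq1 ?addr_ge0 ?sqr_ge0 //; case: eqP => //= h.
case: ltP => h1; case: (ltP (1 / 2) b) => h2; case: ltP => h3 //=; exfalso; nra.
Qed.

Lemma nroots_comp_sqr (P : {poly C}) : P != 0 ->
  nroots in_cap (P \Po (- 'X ^+ 2)) = nroots in_arc P.
Proof.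
have factor (z : C) : exists w : C, z = - w ^+ 2 /\
    ('X - z%:P) \Po (- 'X ^+ 2) = (-1) *: (('X - w%:P) * ('X - (- w)%:P)).
  (* - X^2 - z = - (X - w) (X + w) for a square root w of - z. *)
  exists (sqrtC (- z)); rewrite sqrtCK opprK; split=> //.
  have zE : z%:P = - (sqrtC (- z))%:P ^+ 2 :> {poly C}.
    by rewrite -polyC_exp sqrtCK polyCN opprK.
  rewrite comp_polyB comp_polyX comp_polyC {1}zE polyCN scaleN1r; ring.
move=> /poly_split[c [s [c0 ->]]]; rewrite nroots_prod // comp_polyZ.
have nz (z : C) : ('X - z%:P) \Po (- 'X ^+ 2) != 0.
  have [w [_ ->]] := factor z.
  by rewrite scaler_eq0 oppr_eq0 oner_eq0 mulf_neq0 ?polyXsubC_eq0.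
have -> : (\prod_(z <- s) ('X - z%:P)) \Po (- 'X ^+ 2) =
   \prod_(z <- s) (('X - z%:P) \Po (- 'X ^+ 2)) by exact: rmorph_prod.
rewrite nrootsZ //; last by rewrite prodf_seq_neq0; apply/allP => z _; exact: nz.
rewrite nroots_prodr // -sum1_count [RHS]big_mkcond /=; apply: eq_bigr => z _.
have [w [-> ->]] := factor z.
rewrite nrootsZ ?oppr_eq0 ?oner_eq0 ?mulf_neq0 ?polyXsubC_eq0 //.
rewrite nrootsM ?polyXsubC_eq0 // !nroots_XsubC -in_arc_sqr.
by case: in_arc.
Qed.

(** The polynomial in s equal to s^K G (s + 1/s), for K at least the degree
    of G. *)
Definition reciprocal (K : nat) (G : {poly C}) : {poly C} :=
  \sum_(j < size G) G`_j *: ('X ^+ (K - j) * ('X ^+ 2 + 1) ^+ j).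

Lemma horner_reciprocal K (G : {poly C}) (s : C) : (size G <= K)%N -> s != 0 ->
  (reciprocal K G).[s] = s ^+ K * G.[s + s^-1].
Proof.
move=> hK s0; rewrite /reciprocal horner_sum horner_coef mulr_sumr.
apply: eq_bigr => j _; have jK : (j <= K)%N by rewrite ltnW // (leq_trans _ hK).
have E : ('X ^+ 2 + 1).[s] = s * (s + s^-1).
  by rewrite !(hornerE, horner_exp) /= mulrDr divff // expr2.
rewrite hornerZ mulrCA hornerM !horner_exp E hornerX; congr (_ * _).
by rewrite exprMn mulrA -exprD subnK.
Qed.

(** On the unit circle s + 1/s = 2 Re s. *)
Lemma cap_joukowski (s : C) : in_cap s ->
  s != 0 /\ exists2 x : R, x ^+ 2 < 3 & s + s^-1 = toC x.
Proof.
case: s => a b /andP[/eqP /= h hb].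
have s0 : (a +i* b)%C != 0 by rewrite eq_complex /=; apply/nandP; right; apply/eqP; lra.
split=> //; exists (2 * a); first by nra.
apply: (mulfI s0); rewrite mulrDr divff //.
by apply/eqP; rewrite eq_complex /=; apply/andP; split; apply/eqP; nra.
Qed.

(** The roots are conjugate points of the unit circle with real part r / 2, so
    the condition on r puts exactly one of them in the cap. *)
Lemma nroots_cap_quadratic (r : R) : r ^+ 2 < 3 ->
  nroots in_cap ('X ^+ 2 - (toC r) *: 'X + 1) = 1%N.
Proof.
move=> hr; pose b := Num.sqrt (1 - r ^+ 2 / 4).
have b2 : b ^+ 2 = 1 - r ^+ 2 / 4 by rewrite sqr_sqrtr //; lra.
have b0 : 0 <= b by exact: sqrtr_ge0.
pose z : C := (r / 2 +i* b)%C; pose z' : C := (r / 2 -i* b)%C.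
have -> : 'X ^+ 2 - (toC r) *: 'X + 1 = ('X - z%:P) * ('X - z'%:P) :> {poly C}.
  have <- : z + z' = toC r.
    by apply/eqP; rewrite eq_complex /=; apply/andP; split; apply/eqP; [field | ring].
  have h1 : z * z' = 1.
    by apply/eqP; rewrite eq_complex /=; apply/andP; split; apply/eqP; [nra | ring].
  rewrite -polyC1 -h1 -mul_polyC polyCD polyCM; ring.
rewrite nrootsM ?polyXsubC_eq0 // !nroots_XsubC /in_cap /=.
have -> : (r / 2) ^+ 2 + b ^+ 2 == 1 by apply/eqP; lra.
have -> : 1 / 2 < b by nra.
by rewrite (_ : 1 / 2 < - b = false) ?andbF //; apply/negbTE; rewrite -leNgt; lra.
Qed.

(** An instance of homogeneity with scaling factor s, because
    s (s + 1/s) = 1 + s^2. *)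
Lemma horner_alex_num u (s : C) : s != 0 ->
  (map_poly intr (alex_num u)).[- s ^+ 2] =
  s ^+ size u * (map_poly toC (real_num R u)).[s + s^-1].
Proof.
move=> s0.
have -> : (map_poly toC (real_num R u)).[s + s^-1] = char_diff (s + s^-1) 1 u.
  rewrite -[LHS]/(horner_eval (s + s^-1) _) /real_num !rmorph_char_diff /=.
  by rewrite map_polyX rmorph1 /horner_eval hornerX hornerC.
rewrite -char_diffZ mulr1 mulrDr divff // -expr2.
rewrite -[LHS]/(horner_eval (- s ^+ 2) _) /alex_num !rmorph_char_diff /=.
have -> : map_poly intr (1 - 'X) = 1 - 'X :> {poly C}.
  by rewrite rmorphB rmorph1 /= map_polyX.
have -> : map_poly intr (- 'X) = - 'X :> {poly C} by rewrite rmorphN /= map_polyX.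
by rewrite /horner_eval !hornerE !opprK addrC.
Qed.

Lemma horner0_neq0 (P : {poly C}) : P.[0] = 1 -> P != 0.
Proof. by move=> P1; apply: contra_eq_neq P1 => ->; rewrite horner0 eq_sym oner_eq0. Qed.

Lemma map_alex_num0 u : both_letters u ->
  (map_poly intr (alex_num u) : {poly C}).[0] = 1.
Proof. by move=> mu; rewrite -[0](rmorph0 intr) horner_map alex_num0. Qed.

Lemma comp_alex_num_neq0 u : both_letters u ->
  (map_poly intr (alex_num u) : {poly C}) \Po (- 'X ^+ 2) != 0.
Proof.
move=> mu; apply: horner0_neq0; rewrite horner_comp hornerN horner_exp hornerX.
by rewrite expr0n oppr0 map_alex_num0.
Qed.

Lemma real_num_neq0 u : both_letters u -> real_num R u != 0.
Proof.
move=> mu; apply: contraNneq (comp_alex_num_neq0 mu) => F0.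
have : 'X * ((map_poly intr (alex_num u) : {poly C}) \Po (- 'X ^+ 2)) = 0.
  apply: poly_fun_inj => s; rewrite hornerM hornerX horner0.
  have [->|s0] := eqVneq s 0; first by rewrite mul0r.
  rewrite horner_comp hornerN horner_exp hornerX horner_alex_num // F0.
  by rewrite rmorph0 horner0 !mulr0.
by move/eqP; rewrite mulf_eq0 polyX_eq0.
Qed.

(** Substituting - s^2 turns arc roots into cap roots.  After clearing
    denominators in [horner_alex_num] the other side is a product: each root r
    of F in the interval contributes a factor s^2 - r s + 1 with one cap root,
    while the powers of s and the factor coming from G have no cap root. *)
Lemma nroots_alex_num u rs (G : {poly R}) : both_letters u ->
  real_num R u = \prod_(r <- rs) ('X - r%:P) * G ->
  all (fun x => - arc_bound R < x < arc_bound R) rs ->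
  (forall x, - arc_bound R < x < arc_bound R -> G.[x] != 0) ->
  nroots in_arc (map_poly intr (alex_num u)) = size rs.
Proof.
move=> mu FE Irs G0; set g := map_poly _ _.
have g0 : g != 0 by apply: horner0_neq0; exact: map_alex_num0.
pose quad (r : R) : {poly C} := 'X ^+ 2 - (toC r) *: 'X + 1.
have quadE (s : C) r : s != 0 -> (quad r).[s] = s * (s + s^-1 - toC r).
  move=> s0; rewrite /quad !(hornerE, horner_exp) /= mulrBr mulrDr divff //.
  by rewrite -expr2 addrAC [s * _]mulrC.
pose GC := map_poly toC G; pose K := size GC.
(* The extra factor X on both sides makes the identity trivial at s = 0. *)
have key : 'X ^+ (size rs + K).+1 * (g \Po (- 'X ^+ 2)) =
   'X ^+ (size u).+1 * ((\prod_(r <- rs) quad r) * reciprocal K GC).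
  apply: poly_fun_inj => s; have [->|s0] := eqVneq s 0.
    by rewrite !hornerM !horner_exp hornerX !expr0n !mul0r.
  rewrite !hornerM !horner_exp hornerX horner_reciprocal // horner_comp.
  have -> : (- 'X ^+ 2).[s] = - s ^+ 2 by rewrite hornerN horner_exp hornerX.
  have -> : (\prod_(r <- rs) quad r).[s] =
      s ^+ size rs * \prod_(r <- rs) (s + s^-1 - toC r).
    rewrite horner_prod (eq_bigr _ (fun r _ => quadE s r s0)) big_split /=.
    by rewrite big_const_seq count_predT iter_mulr_1.
  have -> : g.[- s ^+ 2] = s ^+ size u *
      (\prod_(r <- rs) (s + s^-1 - toC r) * GC.[s + s^-1]).
    rewrite horner_alex_num //; congr (_ * _).
    rewrite FE rmorphM rmorph_prod /= hornerM horner_prod; congr (_ * _).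
    by apply: eq_bigr => r _; rewrite rmorphB /= map_polyX map_polyC /= hornerXsubC.
  rewrite !exprS exprD; ring.
have gc0 := comp_alex_num_neq0 mu.
have quad0 r : quad r != 0.
  by apply: horner0_neq0; rewrite /quad !(hornerE, horner_exp) expr0n subr0 add0r.
have Xn0 k : 'X ^+ k != 0 :> {poly C} by rewrite monic_neq0 ?monicXn.
have nX k : nroots in_cap ('X ^+ k) = 0%N.
  apply: nroots_eq0 => // z /cap_joukowski[z0 _].
  by rewrite rootE horner_exp hornerX expf_neq0.
have : 'X ^+ (size rs + K).+1 * (g \Po (- 'X ^+ 2)) != 0 by rewrite mulf_neq0.
rewrite key !mulf_eq0 !negb_or => /andP[_ /andP[pq0 rec0]].
have := congr1 (nroots in_cap) key.
rewrite nrootsM // nX add0n nroots_comp_sqr // => NE; rewrite NE.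
rewrite nrootsM // ?mulf_neq0 // nX add0n nrootsM // nroots_prodr //.
rewrite (@nroots_eq0 _ _ (reciprocal K GC)) // => [|z zcap]; last first.
  (* On the cap s + 1/s lies in the interval, where G does not vanish. *)
  have [z0 [x x3 xE]] := cap_joukowski zcap.
  rewrite rootE horner_reciprocal // xE mulf_neq0 ?expf_neq0 // horner_map fmorph_eq0.
  by rewrite G0 // arc_boundP.
rewrite addn0 -sum1_size !big_seq; apply: eq_bigr => r /(allP Irs).
by rewrite arc_boundP; exact: nroots_cap_quadratic.
Qed.

End ArcCount.

(** * Counting and rounding *)

Lemma real_num_parity (R : realType) u x :
  (real_num R u).[- x] = (-1) ^+ size u * (real_num R u).[x].
Proof.
by rewrite !horner_real_num -char_diffZ sqrrN expr1n mulr1 mulN1r.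
Qed.

Lemma arc_roots_alex_num (R : realType) u : both_letters u ->
  let m := nroots (@in_arc R) (map_poly intr (alex_num u)) in
  odd m = odd (size u) /\ ((5 * size u).-1 %/ 6 - size u %/ 6 <= m.+1)%N.
Proof.
move=> mu; have n0 := ltnW (both_letters_size mu).
have [rs [G [FE Irs G0]]] :=
  root_free_factor (- arc_bound R) (arc_bound R) (real_num_neq0 R mu).
rewrite /= (nroots_alex_num mu FE Irs G0); split.
  exact: root_parity (arc_bound_gt0 R) FE Irs G0 (real_num_parity u).
have [srt Ixs alt] := real_num_alternates R n0.
have := alternation_bound FE G0 srt Ixs alt.
by rewrite size_map size_iota.
Qed.

(** The primitive cube roots of unity are the endpoints of the open arc, so the
    factor t^2 + t + 1 has no root in it. *)
Lemma nroots_arc_quotient (R : realType) u h : both_letters u ->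
  alex_num u = ('X ^+ 2 + 'X + 1) * h ->
  nroots_arc R h = nroots (@in_arc R) (map_poly intr (alex_num u)).
Proof.
move=> mu uh; rewrite nroots_arcE uh rmorphM.
have : map_poly intr (alex_num u) != 0 :> {poly R[i]}.
  by apply: horner0_neq0; exact: map_alex_num0.
rewrite uh rmorphM mulf_eq0 negb_or => /andP[q0 h0].
rewrite nrootsM // (@nroots_eq0 _ _ (map_poly _ ('X ^+ 2 + 'X + 1))) //.
move=> [a b] /andP[/= /eqP h1 h2].
rewrite !rmorphD rmorphXn rmorph1 /= map_polyX rootE !(hornerE, horner_exp) /=.
rewrite eq_complex /=; apply/negP => /andP[/eqP h3 /eqP h4].
have b0 : b = 0.
  have : b * (2 * a + 1) = 0 by rewrite -[RHS]h4; ring.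
  by move/eqP; rewrite mulf_eq0 => /orP[]/eqP // h5; exfalso; clear -h2 h5; lra.
rewrite b0 in h3; clear -h3; nra.
Qed.

Lemma nroots_arcN (R : realType) p : nroots_arc R (- p) = nroots_arc R p.
Proof.
rewrite !nroots_arcE rmorphN /=; have [->|p0] := eqVneq (map_poly intr p : {poly R[i]}) 0.
  by rewrite oppr0.
by rewrite -scaleN1r nrootsZ // oppr_eq0 oner_eq0.
Qed.

Lemma pdegree_alexander u h : both_letters u ->
  alex_num u = ('X ^+ 2 + 'X + 1) * h -> (pdegree h + 2 <= size u)%N.
Proof.
move=> mu uh; have := size_alex_num u; have n2 := both_letters_size mu.
have [->|h0] := eqVneq h 0; first by rewrite /pdegree size_poly0.
have qE : 'X ^+ 2 + 'X + 1 = Poly [:: 1; 1; 1] :> {poly int}.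
  by rewrite /= !cons_poly_def; ring.
have sq : size ('X ^+ 2 + 'X + 1 : {poly int}) = 3%N.
  by rewrite qE (PolyK (c := 0)).
have qm : ('X ^+ 2 + 'X + 1 : {poly int}) \is monic.
  by rewrite monicE lead_coefE sq qE (PolyK (c := 0)).
rewrite uh size_monicM // sq /pdegree; have := h0; rewrite -size_poly_gt0; lia.
Qed.

(** An even integer 2 j is at least 2 (d - 1) / 3 exactly when 3 j >= d - 1, and
    the least such j is the floor of (d + 1) / 3. *)
Lemma ceil_even_r p : ceil_even (r_of p) (2 * ((pdegree p).+1 %/ 3)%N)%N.
Proof.
rewrite /ceil_even /smallest_int /r_of; set d := pdegree p.
have le k : (2 / 3 * (d%:R - 1) <= k%:~R :> rat) = (2 * (d%:Z - 1) <= 3 * k).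
  rewrite -(ler_int rat) !rmorphM rmorphB /=.
  by apply/idP/idP; lra.
rewrite le; split; first by split; lia.
by move=> k; rewrite le => -[/dvdzP[j ->]]; lia.
Qed.

(** An odd integer 2 j + 1 is at least 2 (d - 1) / 3 exactly when
    6 j >= 2 d - 5, and the least such j is the floor of d / 3. *)
Lemma ceil_odd_r p : ceil_odd (r_of p) (2 * (pdegree p %/ 3)%N).+1.
Proof.
rewrite /ceil_odd /smallest_int /r_of; set d := pdegree p.
have le k : (2 / 3 * (d%:R - 1) <= k%:~R :> rat) = (2 * (d%:Z - 1) <= 3 * k).
  rewrite -(ler_int rat) !rmorphM rmorphB /=.
  by apply/idP/idP; lra.
rewrite le; split; first by split; lia.
move=> k; rewrite le => -[k2]; lia.
Qed.

Theorem corollary5p7 (R : realType) (w : braid_word) :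
  positive_braid w -> ~ gen_power w ->
  (exists p : {poly int}, alexander_rep w p) /\
  forall p : {poly int}, alexander_rep w p ->
    [/\ r_of p <= (nroots_arc R p)%:R,
        odd (closure_components w) ->
          exists2 m : int, ceil_even (r_of p) m & m <= (nroots_arc R p)%:Z
      & ~~ odd (closure_components w) ->
          exists2 m : int, ceil_odd (r_of p) m & m <= (nroots_arc R p)%:Z].
Proof.
move=> [u wu] npow.
have mu : both_letters u by move=> g n ug; apply: npow; exists g, n; rewrite -ug.
have [h uh] := alex_num_dvd u.
have repE p : alexander_rep w p = alexander_rep (positive_word u) p.
  by rewrite /alexander_rep (alexander_eq wu).
split; first by exists h; rewrite repE; have [] := alexander_rep_quotient mu uh.
move=> p; rewrite repE => /(proj2 (alexander_rep_quotient mu uh)) ph.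
have [mE dE] : nroots_arc R p = nroots_arc R h /\ pdegree p = pdegree h.
  by case: ph => ->; rewrite ?nroots_arcN /pdegree ?size_polyN.
have [] := arc_roots_alex_num R mu; rewrite -(nroots_arc_quotient R mu uh) -mE.
have := pdegree_alexander mu uh; rewrite -dE.
rewrite (closure_components_eq wu) odd_closure_components.
set m := nroots_arc R p; set n := size u => dn mn Nm.
have n2 := both_letters_size mu.
split.
- have : (2 * pdegree p <= 3 * m + 2)%N by rewrite -/n in n2; lia.
  rewrite -(ler_nat rat) natrD !natrM /r_of; lra.
- move=> no; exists (2 * ((pdegree p).+1 %/ 3)%N)%N; first exact: ceil_even_r.
  by rewrite -/n in n2; lia.
- move=> no; exists (2 * (pdegree p %/ 3)%N).+1; first exact: ceil_odd_r.
  by rewrite -/n in n2; lia.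
Qed.
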